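(* Let $\Lambda$ be an $\Omega_{\mathcal{G}}$-algebra. Then $\Lambda$ is CM-finite, i.e. there are only finitely many isomorphism classes of indecomposable finitely generated Gorenstein projective $\Lambda$-modules.
   Context: Modules are finitely generated right modules and $\mathrm{mod}\text{-}\Lambda$ is their category. For an Artin algebra $\Lambda$, $\mathrm{prj}\text{-}\Lambda$ is the category of projective modules in $\mathrm{mod}\text{-}\Lambda$. A module is Gorenstein projective if it is isomorphic to a syzygy of a totally acyclic complex, i.e. an acyclic complex $P^\bullet$ over $\mathrm{prj}\text{-}\Lambda$ such that $\mathrm{Hom}_\Lambda(P^\bullet,\Lambda)$ is also acyclic. $\mathrm{Gprj}\text{-}\Lambda$ is the full subcategory of Gorenstein projective modules. $\underline{\mathrm{Gprj}}\text{-}\Lambda$ is its stable category: same objects, morphisms modulo those factoring through a projective module. For an additive category $\mathcal{X}$, $\mathrm{mod}\text{-}\mathcal{X}$ is the category of finitely presented contravariant additive functors $F:\mathcal{X}\to\mathrm{Ab}$, i.e. those admitting an exact sequence $\mathcal{X}(-,X)\to\mathcal{X}(-,X')\to F\to 0$. An Artin algebra $\Lambda$, with $\mathrm{Gprj}\text{-}\Lambda$ contravariantly finite in $\mathrm{mod}\text{-}\Lambda$ (every $M\in\mathrm{mod}\text{-}\Lambda$ has a right $\mathrm{Gprj}\text{-}\Lambda$-approximation), is called an $\Omega_{\mathcal{G}}$-algebra if $\mathrm{mod}\text{-}(\underline{\mathrm{Gprj}}\text{-}\Lambda)$ is a semisimple abelian category, i.e. all its objects are projective. *)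

(* Defs.v *)
From HB Require Import structures.
From mathcomp Require Import all_boot all_algebra.
From mathcomp Require Import boolp.

Set Implicit Arguments.
Unset Strict Implicit.
Unset Printing Implicit Defensive.

Import GRing.Theory.
Local Open Scope ring_scope.
Local Open Scope quotient_scope.

Definition surjective (A B : Type) (f : A -> B) := forall b, exists a, f a = b.

Definition exact_at (A B : Type) (C : zmodType) (f : A -> B) (g : B -> C) :=
  forall b, g b = 0 <-> exists a, f a = b.

Lemma linear_ext (R : pzRingType) (M N : lmodType R) (f g : {linear M -> N}) :
  f =1 g -> f = g.
Proof.
move=> /funext; case: f => f [[fa] [fb]]; case: g => g [[ga] [gb]] /= fg.
subst g; by rewrite (Prop_irrelevance fa ga) (Prop_irrelevance fb gb).
Qed.

Lemma additive_ext (M N : zmodType) (f g : {additive M -> N}) : f =1 g -> f = g.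
Proof.
move=> /funext; case: f => f [[fa]]; case: g => g [[ga]] /= fg.
by subst g; rewrite (Prop_irrelevance fa ga).
Qed.

Section LinearZmod.
Variables (R : pzRingType) (M N : lmodType R).

HB.instance Definition _ := gen_eqMixin {linear M -> N}.
HB.instance Definition _ := gen_choiceMixin {linear M -> N}.

Definition lin_zero : {linear M -> N} := \0 : M -> N.
Definition lin_add (f g : {linear M -> N}) : {linear M -> N} := f \+ g.
Definition lin_opp (f : {linear M -> N}) : {linear M -> N} := \- f.

Fact lin_addA : associative lin_add.
Proof. by move=> f g h; apply: linear_ext => x /=; rewrite addrA. Qed.
Fact lin_addC : commutative lin_add.
Proof. by move=> f g; apply: linear_ext => x /=; rewrite addrC. Qed.
Fact lin_add0 : left_id lin_zero lin_add.
Proof. by move=> f; apply: linear_ext => x /=; rewrite add0r. Qed.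
Fact lin_addN : left_inverse lin_zero lin_opp lin_add.
Proof. by move=> f; apply: linear_ext => x /=; rewrite addNr. Qed.

HB.instance Definition _ := GRing.isZmodule.Build {linear M -> N}
  lin_addA lin_addC lin_add0 lin_addN.

End LinearZmod.

Definition fin_gen (R : pzRingType) (M : lmodType R) :=
  exists (n : nat) (g : 'I_n -> M),
    forall x, exists c : 'I_n -> R, x = \sum_i c i *: g i.

Definition artinian (k : comNzRingType) :=
  forall I : nat -> {pred k^o},
    (forall n, submod_closed (I n)) ->
    (forall n, {subset I n.+1 <= I n}) ->
    exists m, forall n, (m <= n)%N -> I n =i I m.

Definition artin_algebra (k : comNzRingType) (L : algType k) :=
  artinian k /\ fin_gen L.

(* Right R-modules are left modules over the opposite ring R^c. *)
Notation rmodType R := (lmodType R^c).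

(* The right regular module: here a *: x is the product x * a of R. *)
Notation regular_rmod R := (R^c^o : rmodType R).

Record fgmod (R : nzRingType) :=
  FgMod { fgmod_car :> rmodType R; fgmod_fg : fin_gen fgmod_car }.

Definition isomorphic (R : nzRingType) (M N : rmodType R) :=
  exists f : {linear M -> N}, bijective f.

Definition zero_mod (R : nzRingType) (M : rmodType R) := forall x : M, x = 0.

Definition indecomposable (R : nzRingType) (M : rmodType R) :=
  ~ zero_mod M /\
  forall A B : rmodType R,
    isomorphic M (A * B)%type -> zero_mod A \/ zero_mod B.

Definition projective_mod (R : nzRingType) (P : rmodType R) :=
  forall (A B : rmodType R) (g : {linear A -> B}), surjective g ->
  forall f : {linear P -> B}, exists h : {linear P -> A}, g \o h =1 f.

(* The map Hom(d, R) : Hom(N, R) -> Hom(M, R). *)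
Definition dual_map (R : nzRingType) (M N : rmodType R) (d : {linear M -> N})
  (f : {linear N -> regular_rmod R}) : {linear M -> regular_rmod R} := f \o d.

Definition totally_acyclic (R : nzRingType) (P : int -> fgmod R)
    (d : forall i, {linear P i -> P (i + 1)}) :=
  [/\ forall i, projective_mod (P i),
      forall i, exact_at (d i) (d (i + 1)) &
      forall i, exact_at (dual_map (d (i + 1))) (dual_map (d i))].

(* f identifies M with the kernel of d i. *)
Definition gorenstein_projective (R : nzRingType) (M : fgmod R) :=
  exists (P : int -> fgmod R) (d : forall i, {linear P i -> P (i + 1)}),
    totally_acyclic d /\
    exists (i : int) (f : {linear M -> P i}), injective f /\ exact_at f (d i).

Definition right_approximation (R : nzRingType) (C : fgmod R -> Prop)
    (M G : fgmod R) (f : {linear G -> M}) :=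
  C G /\ forall G' : fgmod R, C G' ->
    forall f' : {linear G' -> M}, exists h : {linear G' -> G}, f \o h =1 f'.

Definition contravariantly_finite (R : nzRingType) (C : fgmod R -> Prop) :=
  forall M : fgmod R, exists (G : fgmod R) (f : {linear G -> M}),
    right_approximation C f.

Definition CM_finite (R : nzRingType) :=
  exists (n : nat) (G : 'I_n -> fgmod R), forall M : fgmod R,
    gorenstein_projective M -> indecomposable M ->
    exists i, isomorphic M (G i).

Record category := Category {
  cat_ob :> Type;
  cat_hom : cat_ob -> cat_ob -> Type;
  cat_id : forall A, cat_hom A A;
  cat_comp : forall A B C, cat_hom B C -> cat_hom A B -> cat_hom A C;
  cat_compA : forall A B C D
    (h : cat_hom C D) (g : cat_hom B C) (f : cat_hom A B),
    cat_comp h (cat_comp g f) = cat_comp (cat_comp h g) f;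
  cat_comp1l : forall A B (f : cat_hom A B), cat_comp (cat_id B) f = f;
  cat_comp1r : forall A B (f : cat_hom A B), cat_comp f (cat_id A) = f
}.

Section CategoryNotions.
Variable C : category.
Local Notation Hom := (@cat_hom C).
Local Notation "g \c f" := (cat_comp g f) (at level 40, left associativity).

Definition mono (A B : C) (f : Hom A B) :=
  forall D (g h : Hom D A), f \c g = f \c h -> g = h.

Definition epi (A B : C) (f : Hom A B) :=
  forall D (g h : Hom B D), g \c f = h \c f -> g = h.

Definition projective_object (P : C) :=
  forall (A B : C) (e : Hom A B), epi e ->
  forall f : Hom P B, exists g : Hom P A, e \c g = f.

Definition zero_object (Z : C) :=
  forall A, (exists f : Hom A Z, forall g, g = f) /\
            (exists f : Hom Z A, forall g, g = f).

Definition zero_morphism (A B : C) (f : Hom A B) :=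
  exists2 Z, zero_object Z & exists (g : Hom Z B) (h : Hom A Z), f = g \c h.

Definition is_kernel (A B K : C) (f : Hom A B) (i : Hom K A) :=
  zero_morphism (f \c i) /\
  forall D (g : Hom D A), zero_morphism (f \c g) ->
    exists! u : Hom D K, i \c u = g.

Definition is_cokernel (A B Q : C) (f : Hom A B) (p : Hom B Q) :=
  zero_morphism (p \c f) /\
  forall D (g : Hom B D), zero_morphism (g \c f) ->
    exists! u : Hom Q D, u \c p = g.

Definition is_product (A B P : C) (p : Hom P A) (q : Hom P B) :=
  forall D (f : Hom D A) (g : Hom D B),
    exists! u : Hom D P, p \c u = f /\ q \c u = g.

Definition is_coproduct (A B S : C) (i : Hom A S) (j : Hom B S) :=
  forall D (f : Hom A D) (g : Hom B D),
    exists! u : Hom S D, u \c i = f /\ u \c j = g.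

(* Freyd's axioms; the additive structure on the hom-sets is determined by
   them and so is not part of the data. *)
Record abelian : Prop := Abelian {
  abelian_zero : exists Z : C, zero_object Z;
  abelian_prod : forall A B, exists P (p : Hom P A) (q : Hom P B),
    is_product p q;
  abelian_coprod : forall A B, exists S (i : Hom A S) (j : Hom B S),
    is_coproduct i j;
  abelian_ker : forall A B (f : Hom A B), exists K (i : Hom K A),
    is_kernel f i;
  abelian_coker : forall A B (f : Hom A B), exists Q (p : Hom B Q),
    is_cokernel f p;
  abelian_mono : forall A B (f : Hom A B), mono f ->
    exists D (g : Hom B D), is_kernel g f;
  abelian_epi : forall A B (f : Hom A B), epi f ->
    exists D (g : Hom D A), is_cokernel g f
}.

Definition semisimple_abelian := abelian /\ forall P : C, projective_object P.

End CategoryNotions.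

Record preadditive := Preadditive {
  pre_ob :> Type;
  pre_hom : pre_ob -> pre_ob -> zmodType;
  pre_id : forall A, pre_hom A A;
  pre_comp : forall A B C, pre_hom B C -> pre_hom A B -> pre_hom A C;
  pre_compA : forall A B C D
    (h : pre_hom C D) (g : pre_hom B C) (f : pre_hom A B),
    pre_comp h (pre_comp g f) = pre_comp (pre_comp h g) f;
  pre_comp1l : forall A B (f : pre_hom A B), pre_comp (pre_id B) f = f;
  pre_comp1r : forall A B (f : pre_hom A B), pre_comp f (pre_id A) = f;
  pre_compDl : forall A B C (g g' : pre_hom B C) (f : pre_hom A B),
    pre_comp (g + g') f = pre_comp g f + pre_comp g' f;
  pre_compDr : forall A B C (g : pre_hom B C) (f f' : pre_hom A B),
    pre_comp g (f + f') = pre_comp g f + pre_comp g f'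
}.

Section FunctorCategory.
Variable X : preadditive.

Record cofunctor := Cofunctor {
  fun_ob :> X -> zmodType;
  fun_map : forall A B, pre_hom A B -> {additive fun_ob B -> fun_ob A};
  fun_map1 : forall A (x : fun_ob A), fun_map (pre_id A) x = x;
  fun_mapM : forall A B C (g : pre_hom B C) (f : pre_hom A B) (x : fun_ob C),
    fun_map (pre_comp g f) x = fun_map f (fun_map g x);
  fun_mapD : forall A B (f g : pre_hom A B) (x : fun_ob B),
    fun_map (f + g) x = fun_map f x + fun_map g x
}.

Record nattrans (F G : cofunctor) := NatTrans {
  nat_map :> forall A, {additive F A -> G A};
  nat_natural : forall A B (f : pre_hom A B) (x : F B),
    nat_map A (fun_map F f x) = fun_map G f (nat_map B x)
}.

Lemma nattrans_ext (F G : cofunctor) (s t : nattrans F G) :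
  (forall A, s A =1 t A) -> s = t.
Proof.
case: s => s sP; case: t => t tP /= st.
have e : s = t by apply: functional_extensionality_dep => A; apply: additive_ext; exact: st.
by subst t; rewrite (Prop_irrelevance sP tP).
Qed.

Definition nat_id (F : cofunctor) : nattrans F F :=
  @NatTrans F F (fun A => idfun) (fun _ _ _ _ => erefl).

Section NatComp.
Variables (F G H : cofunctor) (t : nattrans G H) (s : nattrans F G).

Fact nat_comp_natural A B (f : pre_hom A B) (x : F B) :
  (t A \o s A) (fun_map F f x) = fun_map H f ((t B \o s B) x).
Proof. by rewrite /= !nat_natural. Qed.

Definition nat_comp : nattrans F H :=
  @NatTrans F H (fun A => t A \o s A) nat_comp_natural.

End NatComp.

Fact nat_compA (F G H K : cofunctor)
    (h : nattrans H K) (g : nattrans G H) (f : nattrans F G) :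
  nat_comp h (nat_comp g f) = nat_comp (nat_comp h g) f.
Proof. exact: nattrans_ext. Qed.
Fact nat_comp1l (F G : cofunctor) (f : nattrans F G) :
  nat_comp (nat_id G) f = f.
Proof. exact: nattrans_ext. Qed.
Fact nat_comp1r (F G : cofunctor) (f : nattrans F G) :
  nat_comp f (nat_id F) = f.
Proof. exact: nattrans_ext. Qed.

Section Yoneda.
Variable Z : X.

Section Map.
Variables (A B : X) (f : pre_hom A B).
Definition yoneda_map (g : pre_hom B Z) : pre_hom A Z := pre_comp g f.
Fact yoneda_map_is_additive : zmod_morphism yoneda_map.
Proof.
move=> g h; apply: (addIr (yoneda_map h)).
by rewrite subrK -pre_compDl subrK.
Qed.
HB.instance Definition _ :=
  GRing.isZmodMorphism.Build (pre_hom B Z) (pre_hom A Z) yoneda_map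
    yoneda_map_is_additive.
End Map.

Definition yoneda : cofunctor :=
  @Cofunctor (fun A => pre_hom A Z) (fun A B f => yoneda_map f)
    (fun A x => pre_comp1r x)
    (fun A B C g f x => pre_compA x g f)
    (fun A B f g x => pre_compDr x f g).

End Yoneda.

Definition fin_presented (F : cofunctor) :=
  exists (Z Z' : X) (s : nattrans (yoneda Z) (yoneda Z'))
         (t : nattrans (yoneda Z') F),
    forall A, exact_at (s A) (t A) /\ surjective (t A).

(* mod-X *)
Definition fpfun_cat : category :=
  @Category {F : cofunctor | fin_presented F}
    (fun F G => nattrans (sval F) (sval G))
    (fun F => nat_id (sval F))
    (fun F G H t s => nat_comp t s)
    (fun _ _ _ _ h g f => nat_compA h g f)
    (fun _ _ f => nat_comp1l f)
    (fun _ _ f => nat_comp1r f).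

End FunctorCategory.

Definition factors_projective (R : nzRingType) (M N : rmodType R)
    (f : {linear M -> N}) :=
  exists2 P : fgmod R, projective_mod P &
    exists (g : {linear P -> N}) (h : {linear M -> P}), f =1 g \o h.

Section SumOfProjectives.
Variables (R : nzRingType) (P Q : fgmod R).

Definition inl_lin (u : P) : (P * Q)%type := (u, 0).
Definition inr_lin (v : Q) : (P * Q)%type := (0, v).

Fact inl_lin_linear : linear inl_lin.
Proof. by move=> a u v; congr pair; rewrite /= scaler0 addr0. Qed.
Fact inr_lin_linear : linear inr_lin.
Proof. by move=> a u v; congr pair; rewrite /= scaler0 addr0. Qed.

HB.instance Definition _ :=
  GRing.isLinear.Build R^c P (P * Q)%type _ inl_lin inl_lin_linear.
HB.instance Definition _ :=
  GRing.isLinear.Build R^c Q (P * Q)%type _ inr_lin inr_lin_linear.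

Fact prod_fin_gen : fin_gen ((P * Q)%type : rmodType R).
Proof.
have [m [g gP]] := fgmod_fg P; have [n [h hP]] := fgmod_fg Q.
exists (m + n)%N.
exists (fun i => match split i with inl j => (g j, 0) | inr j => (0, h j) end).
move=> [x y]; have [c cx] := gP x; have [d dy] := hP y.
exists (fun i => match split i with inl j => c j | inr j => d j end).
rewrite big_split_ord /=.
under eq_bigr do rewrite (unsplitK (inl _)).
under [X in _ = _ + X]eq_bigr do rewrite (unsplitK (inr _)).
have -> : (x, y) = inl_lin x + inr_lin y.
  by congr pair; rewrite /= ?addr0 ?add0r.
rewrite cx dy !linear_sum.
by congr (_ + _); apply: eq_bigr => i _; rewrite linearZ.
Qed.

Definition fgmod_prod : fgmod R := FgMod prod_fin_gen.

Fact fgmod_prod_projective :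
  projective_mod P -> projective_mod Q -> projective_mod fgmod_prod.
Proof.
move=> pP pQ A B g g_surj f.
have [h1 h1P] := pP _ _ _ g_surj (f \o inl_lin).
have [h2 h2P] := pQ _ _ _ g_surj (f \o inr_lin).
exists ((h1 \o fst) \+ (h2 \o snd)) => -[x y] /=.
rewrite linearD; have /= -> := h1P x; have /= -> := h2P y.
rewrite -linearD; congr (f _).
by congr pair; rewrite /= ?addr0 ?add0r.
Qed.

End SumOfProjectives.

Section StableHom.
Variables (R : nzRingType) (M N : fgmod R).

Definition projective_maps : {pred {linear M -> N}} :=
  fun f => `[< factors_projective f >].

Fact projective_maps_closed : zmod_closed projective_maps.
Proof.
split.
  have fg0 : fin_gen ('rV[R^c]_0 : rmodType R).
    exists 0%N, (fun=> 0) => x; exists (fun=> 0).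
    by rewrite big_ord0; apply/rowP; case.
  apply/asboolP; exists (FgMod fg0).
    by move=> A B g _ f; exists \0 => x; rewrite /= (thinmx0 x) !linear0.
  by exists \0, \0.
move=> f g /asboolP[P pP [f1 [f2 fE]]] /asboolP[Q pQ [g1 [g2 gE]]].
apply/asboolP; exists (fgmod_prod P Q); first exact: fgmod_prod_projective.
exists ((f1 \o fst) \- (g1 \o snd)).
exists ((@inl_lin _ P Q \o f2) \+ (@inr_lin _ P Q \o g2)) => x /=.
by rewrite addr0 add0r fE gE.
Qed.

HB.instance Definition _ :=
  GRing.isZmodClosed.Build {linear M -> N} projective_maps
    projective_maps_closed.

Definition stable_hom : zmodType := Quotient.quot projective_maps.

Definition stable_class (f : {linear M -> N}) : stable_hom := \pi f.

Fact stable_classP (f g : {linear M -> N}) :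
  stable_class f = stable_class g <-> factors_projective (f - g).
Proof.
have E : (f - g \in projective_maps) = (stable_class f == stable_class g).
  exact: (@Quotient.idealrBE _ projective_maps).
split=> [/eqP|fg]; first by rewrite -E => /asboolP.
by apply/eqP; rewrite -E; apply/asboolP.
Qed.

Fact stable_classD (f g : {linear M -> N}) :
  stable_class (f + g) = stable_class f + stable_class g.
Proof. exact: raddfD. Qed.

Fact stable_classK (u : stable_hom) : stable_class (repr u) = u.
Proof. exact: reprK. Qed.

End StableHom.

Section StableComp.
Variable R : nzRingType.

Definition lin_comp (M N K : fgmod R) (g : {linear N -> K}) (f : {linear M -> N})
  : {linear M -> K} := g \o f.

Definition stable_comp (M N K : fgmod R)
    (v : stable_hom N K) (u : stable_hom M N) : stable_hom M K :=
  stable_class (lin_comp (repr v) (repr u)).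

Fact stable_compE (M N K : fgmod R) (g : {linear N -> K}) (f : {linear M -> N}) :
  stable_comp (stable_class g) (stable_class f) = stable_class (lin_comp g f).
Proof.
have [P pP [g1 [g2 gE]]] : factors_projective (g - repr (stable_class g)).
  by apply/stable_classP; rewrite stable_classK.
have [Q pQ [f1 [f2 fE]]] : factors_projective (f - repr (stable_class f)).
  by apply/stable_classP; rewrite stable_classK.
transitivity (stable_class (lin_comp g (repr (stable_class f)))).
  apply/esym/stable_classP; exists P => //.
  by exists g1, (g2 \o repr (stable_class f)) => x; apply: gE.
apply/esym/stable_classP; exists Q => //; exists (g \o f1), f2 => x /=.
by rewrite -linearB; congr (g _); apply: fE.
Qed.

End StableComp.

Record gpmod (R : nzRingType) :=
  GpMod { gpmod_car :> fgmod R; gpmodP : gorenstein_projective gpmod_car }.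

Section StableCategory.
Variable R : nzRingType.

Fact stable_compA (M N K L : fgmod R) (w : stable_hom K L)
    (v : stable_hom N K) (u : stable_hom M N) :
  stable_comp w (stable_comp v u) = stable_comp (stable_comp w v) u.
Proof.
rewrite -(stable_classK w) -(stable_classK v) -(stable_classK u) !stable_compE.
by congr stable_class; apply: linear_ext.
Qed.

Fact stable_comp1l (M N : fgmod R) (u : stable_hom M N) :
  stable_comp (stable_class idfun) u = u.
Proof.
rewrite -(stable_classK u) stable_compE.
by congr stable_class; apply: linear_ext.
Qed.

Fact stable_comp1r (M N : fgmod R) (u : stable_hom M N) :
  stable_comp u (stable_class idfun) = u.
Proof.
rewrite -(stable_classK u) stable_compE.
by congr stable_class; apply: linear_ext.
Qed.

Fact stable_compDl (M N K : fgmod R) (v v' : stable_hom N K)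
    (u : stable_hom M N) :
  stable_comp (v + v') u = stable_comp v u + stable_comp v' u.
Proof.
rewrite -(stable_classK v) -(stable_classK v') -(stable_classK u).
rewrite -stable_classD !stable_compE -stable_classD.
by congr stable_class; apply: linear_ext.
Qed.

Fact stable_compDr (M N K : fgmod R) (v : stable_hom N K)
    (u u' : stable_hom M N) :
  stable_comp v (u + u') = stable_comp v u + stable_comp v u'.
Proof.
rewrite -(stable_classK v) -(stable_classK u) -(stable_classK u').
rewrite -stable_classD !stable_compE -stable_classD.
by congr stable_class; apply: linear_ext => x; rewrite /= linearD.
Qed.

Definition stable_Gprj : preadditive :=
  @Preadditive (gpmod R) (fun M N => stable_hom M N)
    (fun M => stable_class idfun)
    (fun M N K v u => stable_comp v u)
    (fun M N K L w v u => stable_compA w v u)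
    (fun M N u => stable_comp1l u)
    (fun M N u => stable_comp1r u)
    (fun M N K v v' u => stable_compDl v v' u)
    (fun M N K v u u' => stable_compDr v u u').

End StableCategory.

Definition OmegaG_algebra (k : comNzRingType) (L : algType k) :=
  [/\ artin_algebra L,
      contravariantly_finite (@gorenstein_projective L) &
      semisimple_abelian (fpfun_cat (stable_Gprj L))].

(* Main.v *)
Require Import Defs.
From HB Require Import structures.
From mathcomp Require Import all_boot all_algebra.
From mathcomp Require Import boolp classical_sets.

(* Call L the algebra. Every functor in mod-(stable Gprj) being projective, the
   cokernel of (-, h) splits off, so every stable morphism h between Gorenstein
   projectives is von Neumann regular: h = h g h for some g. Let M be an
   indecomposable Gorenstein projective module and h : M -> X. By Fitting's
   lemma g h is invertible, and then M is a direct summand of X, or it is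
   nilpotent, and then h = h (g h)^n is stably zero.
   Now let X -> T be a right Gprj-approximation of a simple quotient T of M,
   and let h : M -> X lift f : M -> T. If h factors through a projective module
   then f factors as M -> L -> T; lifting L -> T along f gives an endomorphism
   e of M with f e = f, which is not nilpotent, so M is a direct summand of L.
   There are finitely many simple modules T, since each is the top of an
   indecomposable direct summand of L, hence finitely many approximations X,
   and each of them has finitely many indecomposable direct summands. *)

Set Implicit Arguments.
Unset Strict Implicit.
Unset Printing Implicit Defensive.

Import GRing.Theory.
Local Open Scope ring_scope.
Local Open Scope quotient_scope.

(** * Linear maps and endomorphism rings *)

Section LinearMaps.
Variable R : pzRingType.
Implicit Types M N T : lmodType R.

Lemma linear_map_exists M N (f : M -> N) :
  linear f -> exists g : {linear M -> N}, g =1 f.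
Proof.
move=> flin; pose F := GRing.isLinear.Build R M N _ f flin.
by exists (HB.pack_for {linear M -> N} f F).
Qed.

(** The factor is [f] after a set-theoretic section [s] of [p]; the kernel condition makes its
    values independent of [s], hence linear. *)
Lemma linear_factor M N T (p : {linear M -> N}) (f : {linear M -> T}) :
  surjective p -> (forall x, p x = 0 -> f x = 0) ->
  exists g : {linear N -> T}, g \o p =1 f.
Proof.
move=> /choice[s sP] kerpf.
have fE x y : p x = p y -> f x = f y.
  by move=> pxy; apply/eqP; rewrite -subr_eq0 -linearB kerpf // linearB pxy subrr.
have [|g gE] := @linear_map_exists N T (f \o s).
  by move=> a x y /=; rewrite -linearP; apply: fE; rewrite linearP !sP.
by exists g => x /=; rewrite gE; apply: fE; rewrite sP.
Qed.

Lemma linear_inverse M N (f : {linear M -> N}) :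
  bijective f -> exists2 g : {linear N -> M}, cancel f g & cancel g f.
Proof.
move=> [f' fK f'K].
have [||g gE] := @linear_factor M N M f idfun.
- by move=> y; exists (f' y).
- by move=> x fx0; rewrite -[LHS]fK fx0 -(linear0 f) fK.
by exists g => [x|y]; [rewrite -[RHS]gE | rewrite -(f'K y) -[g _]/((g \o f) _) gE].
Qed.

Lemma fin_gen_surj M N (f : {linear M -> N}) :
  surjective f -> fin_gen M -> fin_gen N.
Proof.
move=> fsurj [n [g gP]]; exists n, (f \o g) => y.
have [x <-] := fsurj y; have [c ->] := gP x; exists c.
by rewrite linear_sum; apply: eq_bigr => i _; rewrite linearZ.
Qed.

End LinearMaps.

Section Endomorphisms.
Variables (R : pzRingType) (M : lmodType R).
Implicit Types f g h : {linear M -> M}.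

Definition endo_one : {linear M -> M} := idfun.
Definition endo_mul f g : {linear M -> M} := f \o g.

Fact endo_mulA : associative endo_mul.
Proof. by move=> f g h; apply: linear_ext. Qed.
Fact endo_mul1 : left_id endo_one endo_mul.
Proof. by move=> f; apply: linear_ext. Qed.
Fact endo_mulr1 : right_id endo_one endo_mul.
Proof. by move=> f; apply: linear_ext. Qed.
Fact endo_mulDl : left_distributive endo_mul +%R.
Proof. by move=> f g h; apply: linear_ext. Qed.
Fact endo_mulDr : right_distributive endo_mul +%R.
Proof. by move=> f g h; apply: linear_ext => x /=; apply: linearD. Qed.

HB.instance Definition _ := GRing.Zmodule_isPzRing.Build {linear M -> M}
  endo_mulA endo_mul1 endo_mulr1 endo_mulDl endo_mulDr.

Definition invertible f := exists2 g, g * f = 1 & f * g = 1.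

Lemma endo_subE f g x : (f - g) x = f x - g x. Proof. by []. Qed.
Lemma endo_mulE f g x : (f * g) x = f (g x). Proof. by []. Qed.

Lemma endo_sumE (I : finType) (f : I -> {linear M -> M}) x :
  (\sum_i f i) x = \sum_i f i x.
Proof. by elim/big_rec2: _ => // i y g _ <-. Qed.

(** The inverse is the finite geometric series in [f], which commutes with [f]. *)
Lemma invertible_sub1 f n : f ^+ n = 0 -> invertible (1 - f).
Proof.
move=> fn0; pose s : {linear M -> M} := \sum_(i < n) f ^+ i.
have e : (1 - f) * s = 1.
  by rewrite -opprB mulNr -subrX1 fn0 sub0r opprK.
exists s => //; rewrite -[RHS]e; apply: esym.
apply: commr_sum => i _; apply/commrX/commr_sym/commrB; first exact: commr1.
exact: commr_refl.
Qed.

End Endomorphisms.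

(** * Descending chains of submodules *)

(** Worded so that [artinian k] unfolds to [dcc k^o]. *)
Definition dcc (R : pzRingType) (M : lmodType R) :=
  forall I : nat -> {pred M},
    (forall n, submod_closed (I n)) ->
    (forall n, {subset I n.+1 <= I n}) ->
    exists m, forall n, (m <= n)%N -> I n =i I m.

Lemma fin_gen_family (R : pzRingType) (M : lmodType R) (I : finType) (g : I -> M) :
  (forall x, exists c : I -> R, x = \sum_i c i *: g i) -> fin_gen M.
Proof.
move=> gP; exists #|I|, (g \o enum_val) => x; have [c ->] := gP x.
exists (c \o enum_val).
by rewrite (big_enum_val (A := I)).
Qed.

Section DescendingChains.
Variables (R : pzRingType) (M : lmodType R).

Lemma chain_sub (I : nat -> {pred M}) m n :
  (forall n, {subset I n.+1 <= I n}) -> (m <= n)%N -> {subset I n <= I m}.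
Proof.
move=> Idec /subnK <-; elim: (n - m)%N => [|d IH] x //.
by rewrite addSn => /Idec; apply: IH.
Qed.

(** Induction on the number of generators, using the chain of ideals of first coefficients. *)
Lemma dcc_fin_gen : dcc R^o -> fin_gen M -> dcc M.
Proof.
move=> dccR [n [g gP]] I Isub Idec.
(* This form makes sense for families [g] that do not generate [M], as the induction requires. *)
suff [m mP] : exists m, forall l, (m <= l)%N -> forall c : 'I_n -> R,
    \sum_i c i *: g i \in I m -> \sum_i c i *: g i \in I l.
  exists m => l ml x; apply/idP/idP; first exact: chain_sub.
  by have [c ->] := gP x; apply: mP.
have Ilin a l : {in I l &, forall u v, a *: u + v \in I l} by case: (Isub l).
have IB l : {in I l &, forall u v, u - v \in I l}.
  exact: GRing.linear_closedB (proj2 (Isub l)).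
clear gP; elim: n g => [|n IH] g.
  by exists 0%N => l _ c _; rewrite big_ord0; case: (Isub l).
have [m1 m1P] := IH (g \o lift ord0).
pose J l : {pred R^o} := fun a : R =>
  `[< exists c : 'I_n.+1 -> R, c ord0 = a /\ \sum_i c i *: g i \in I l >].
have [||m2 m2P] := dccR J.
- move=> l; split.
    apply/asboolP; exists (fun=> 0); split=> //.
    by rewrite big1 => [|i _]; [case: (Isub l) | rewrite scale0r].
  move=> a _ _ /asboolP[c [<- cI]] /asboolP[d [<- dI]]; apply/asboolP.
  exists (fun i => a * c i + d i); split=> //.
  under eq_bigr do rewrite scalerDl -scalerA.
  by rewrite big_split /= -scaler_sumr; apply: Ilin.
- by move=> l a /asboolP[c [ca cI]]; apply/asboolP; exists c; split=> //; apply: Idec.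
exists (maxn m1 m2) => l; rewrite geq_max => /andP[m1l m2l] c cI.
have: c ord0 \in J l.
  rewrite m2P // -(m2P (maxn m1 m2)) ?leq_maxr //.
  by apply/asboolP; exists c.
(* An element of [I l] with the same first coefficient; subtracting it leaves a combination of the
   other generators, to which [m1P] applies. *)
case/asboolP=> d [dc dI].
rewrite -(subrK (\sum_i d i *: g i) (\sum_i c i *: g i)).
suff sP: \sum_i c i *: g i - \sum_i d i *: g i \in I l.
  by rewrite -[X in X + _]scale1r; apply: Ilin.
have e : \sum_i c i *: g i - \sum_i d i *: g i =
    \sum_i (c (lift ord0 i) - d (lift ord0 i)) *: (g \o lift ord0) i.
  rewrite !big_ord_recl dc opprD addrACA subrr add0r -sumrB.
  by apply: eq_bigr => i _; rewrite scalerBl.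
rewrite e; apply: m1P; rewrite // -e.
by apply: IB; [apply: chain_sub cI => //; apply: leq_maxl | apply: chain_sub dI].
Qed.

End DescendingChains.

(** Without a minimal member, choice would iterate to a strictly decreasing chain. *)
Lemma dcc_minimal (R : pzRingType) (M : lmodType R) (C : {pred M} -> Prop) :
  dcc M -> (forall P, C P -> submod_closed P) -> (exists P, C P) ->
  exists2 P, C P & forall Q, C Q -> {subset Q <= P} -> {subset P <= Q}.
Proof.
move=> dccM Csub [P0 CP0]; apply: contrapT => noP.
have step (P : {P | C P}) : exists Q : {P | C P},
    {subset sval Q <= sval P} /\ ~ {subset sval P <= sval Q}.
  case: P => P CP; apply: contrapT => noQ; apply: noP.
  by exists P => // Q CQ QP; apply: contrapT => PQ; apply: noQ; exists (exist _ Q CQ).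
have [s sP] := choice step.
pose I n := iter n s (exist _ P0 CP0).
have [||m mP] := dccM (fun n => sval (I n)).
- by move=> n; apply: Csub; case: (I n).
- by move=> n x; apply: (sP (I n)).1.
by apply: (sP (I m)).2 => x; rewrite -[s (I m)]/(I m.+1) (mP m.+1).
Qed.

(** * Restriction of scalars to the base ring *)

Section RestrictionOfScalars.
Variables (k : comNzRingType) (L : algType k).

(** A type alias, so that the structure over [k] does not clash with the one over [L]. *)
Definition restrict_scalars (M : rmodType L) : Type := M.

Section Def.
Variable M : rmodType L.
Local Notation N := (restrict_scalars M).

HB.instance Definition _ := GRing.Zmodule.on N.

Definition rscale (a : k) (x : N) : N := (a%:A : L^c) *: (x : M).

Fact rscaleA a b x : rscale a (rscale b x) = rscale (a * b) x.
Proof.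
rewrite /rscale scalerA; congr (_ *: _).
(* The product of [L^c] is reversed; commutativity of [k] restores the order. *)
by rewrite -[LHS]/((b%:A : L) * a%:A) mulr_algl scalerA mulrC.
Qed.
Fact rscale1 : left_id 1 rscale.
Proof. by move=> x; rewrite /rscale !scale1r. Qed.
Fact rscaleDr : right_distributive rscale +%R.
Proof. by move=> a x y; rewrite /rscale scalerDr. Qed.
Fact rscaleDl x : {morph rscale^~ x : a b / a + b}.
Proof. by move=> a b; rewrite /rscale !scalerDl. Qed.

HB.instance Definition _ := GRing.Zmodule_isLmodule.Build k N
  rscaleA rscale1 rscaleDr rscaleDl.

Lemma rscaleE a (x : N) : a *: x = (a%:A : L^c) *: (x : M).
Proof. by []. Qed.

End Def.

Hypothesis artL : artin_algebra L.

Lemma fin_gen_restrict (M : rmodType L) : fin_gen M -> fin_gen (restrict_scalars M).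
Proof.
case: artL => _ [m [l lP]] [n [g gP]].
apply: (@fin_gen_family k (restrict_scalars M) _ (fun t : 'I_n * 'I_m => (l t.2 : L^c) *: g t.1)) => x.
have [c ->] := gP x; have [d dP] := choice (fun i => lP (c i)).
exists (fun t => d t.1 t.2).
rewrite -(pair_bigA _ (fun i j => d i j *: ((l j : L^c) *: g i : restrict_scalars M))) /=.
apply: eq_bigr => i _; rewrite dP scaler_suml; apply: eq_bigr => j _.
have e : d i j *: l j = ((d i j)%:A : L^c) * (l j : L^c) := esym (mulr_algr _ _).
by rewrite rscaleE [RHS]scalerA; apply: (f_equal (fun a : L^c => a *: g i) e).
Qed.

Lemma dcc_power (M : rmodType L) n : fin_gen M ->
  dcc ({ffun 'I_n -> restrict_scalars M} : lmodType k).
Proof.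
move=> /fin_gen_restrict[m [g gP]]; apply: dcc_fin_gen; first by case: artL.
(* Generators: a generator of [M] in one coordinate, zero in the others. *)
apply: (@fin_gen_family k {ffun 'I_n -> restrict_scalars M} _ (fun t : 'I_n * 'I_m =>
  [ffun i => if i == t.1 then g t.2 else 0])) => x.
have [c cP] := choice (fun i => gP (x i)).
exists (fun t => c t.1 t.2); apply/ffunP => i.
rewrite sum_ffunE -(pair_bigA _ (fun i0 j => (c i0 j *:
  [ffun i1 => if i1 == i0 then g j else 0] : {ffun 'I_n -> restrict_scalars M}) i)) /=.
rewrite (bigD1 i) //= [X in _ + X]big1 ?addr0.
  by rewrite cP; apply: eq_bigr => j _; rewrite !ffunE eqxx.
move=> i' ne; rewrite big1 // => j _; rewrite !ffunE eq_sym (negPf ne).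
exact: scaler0.
Qed.

(** Submodules over [L] are in particular submodules over [k]. *)
Lemma dcc_artin (M : rmodType L) : fin_gen M -> dcc M.
Proof.
move=> /fin_gen_restrict/dcc_fin_gen dccM I Isub Idec.
apply: (dccM _ I) Idec => [|n]; first by case: artL.
by case: (Isub n) => I0 Ilin; split=> // a; apply: Ilin.
Qed.

End RestrictionOfScalars.

(** * Fitting's lemma *)

Section FixedSubmodule.
Variables (R : pzRingType) (M : lmodType R) (e : {linear M -> M}).

(** For an idempotent [e] this is its image, and for [1 - e] it is the kernel of [e]. *)
Definition fixed_points : {pred M} := fun x => e x == x.

Fact fixed_points_closed : submod_closed fixed_points.
Proof.
split; first by rewrite unfold_in linear0.
by move=> a x y /eqP ex /eqP ey; rewrite unfold_in linearP ex ey.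
Qed.

HB.instance Definition _ :=
  GRing.isSubmodClosed.Build R M fixed_points fixed_points_closed.

Record fixed_submod := FixedSubmod {
  fixed_val :> M; _ : fixed_val \in fixed_points }.

HB.instance Definition _ := [isSub for fixed_val].
HB.instance Definition _ := [Choice of fixed_submod by <:].
HB.instance Definition _ := [SubChoice_isSubLmodule of fixed_submod by <:].

Lemma fixedE (x : fixed_submod) : e (val x) = val x.
Proof. by apply/eqP; case: x. Qed.

End FixedSubmodule.

Lemma isomorphic_sym (R : nzRingType) (M N : rmodType R) :
  isomorphic M N -> isomorphic N M.
Proof. by move=> [f /linear_inverse[g fK gK]]; exists g; exists f. Qed.

Section Idempotents.
Variables (R : nzRingType) (M : rmodType R).

(** An idempotent splits [M] into its image and its kernel, one of which must vanish. *)
Lemma indecomposable_idempotent (e : {linear M -> M}) :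
  indecomposable M -> e * e = e -> e = 0 \/ e = 1.
Proof.
move=> [_ indM] ee; pose A := fixed_submod e; pose B := fixed_submod (1 - e).
have eE x : e (e x) = e x by rewrite -endo_mulE ee.
have mA x : e x \in fixed_points e by rewrite unfold_in eE.
have mB x : x - e x \in fixed_points (1 - e).
  by rewrite unfold_in endo_subE /= linearB eE subrr subr0.
have [] := indM A B; last 2 first.
- move=> A0; left; apply: linear_ext => x.
  exact: (congr1 val (A0 (FixedSubmod (mA x)))).
- move=> B0; right; apply: linear_ext => x.
  apply/eqP; rewrite eq_sym -subr_eq0; apply/eqP.
  exact: (congr1 val (B0 (FixedSubmod (mB x)))).
apply: isomorphic_sym.
pose g : {linear (A * B)%type -> M} := (val \o fst) \+ (val \o snd).
exists g; exists (fun x => (FixedSubmod (mA x), FixedSubmod (mB x))).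
  move=> [a b]; have ea := fixedE a.
  have eb : e (val b) = 0.
    by apply/oppr_inj/(addrI (val b)); rewrite oppr0 addr0; apply: (fixedE b).
  by congr pair; apply: val_inj; rewrite /= linearD ea eb addr0 // addrC addKr.
by move=> x; rewrite /= addrC subrK.
Qed.

End Idempotents.

Lemma invertibleM (R : pzRingType) (M : lmodType R) (f g : {linear M -> M}) :
  invertible f -> invertible g -> invertible (f * g).
Proof.
move=> [f' f'f ff'] [g' g'g gg']; exists (g' * f').
  by rewrite mulrA -(mulrA g') f'f mulr1.
by rewrite mulrA -(mulrA f) gg' mulr1.
Qed.

(** Direct summands up to isomorphism, encoded by a split inclusion. *)
Definition retract (R : pzRingType) (M N : lmodType R) :=
  exists (u : {linear M -> N}) (v : {linear N -> M}), cancel u v.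

Lemma retract_invertible (R : pzRingType) (M N : lmodType R)
    (u : {linear M -> N}) (v : {linear N -> M}) :
  invertible (v \o u : {linear M -> M}) -> retract M N.
Proof.
move=> [w wvu _]; exists u, (w \o v) => x.
exact: (congr1 (fun f : {linear M -> M} => f x) wvu).
Qed.

(** The idempotent [u \o v] of [N] is nonzero because [M] is, so it is the identity. *)
Lemma retract_indecomposable (R : nzRingType) (M N : rmodType R) :
  indecomposable N -> ~ zero_mod M -> retract M N -> isomorphic M N.
Proof.
move=> indN M_neq0 [u [v vu]]; pose e : {linear N -> N} := u \o v.
have [|e0|e1] := @indecomposable_idempotent _ _ e indN.
- by apply: linear_ext => x /=; rewrite vu.
- case: M_neq0 => x; have: e (u x) = u x by rewrite /= vu.
  by rewrite e0 => ux0; rewrite -(vu x) -ux0 linear0.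
- exists u; exists v => // y; exact: (congr1 (fun f : {linear N -> N} => f y) e1).
Qed.

Section Fitting.
Variables (k : comNzRingType) (L : algType k).
Hypothesis artL : artin_algebra L.

Lemma linear_eq_gen (R : pzRingType) (M N : lmodType R) n (g : 'I_n -> M)
    (f f' : {linear M -> N}) :
  (forall x, exists c : 'I_n -> R, x = \sum_i c i *: g i) ->
  (forall i, f (g i) = f' (g i)) -> f = f'.
Proof.
move=> gP ff'; apply: linear_ext => x; have [c ->] := gP x.
by rewrite !linear_sum; apply: eq_bigr => i _; rewrite !linearZ ff'.
Qed.

(* The submodules f^j C(f) of End(M), where C(f) is the centralizer of f,
   form a descending chain, and End(M) embeds into M^n. *)
Lemma endo_strongly_regular (M : rmodType L) (f : {linear M -> M}) :
  fin_gen M -> exists m h, GRing.comm f h /\ f ^+ m = f ^+ m.+1 * h.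
Proof.
move=> Mfg; have [n [g gP]] := Mfg.
have central (a : k) (b : L^c) (x : M) :
    (a%:A : L^c) *: (b *: x) = b *: ((a%:A : L^c) *: x).
  have e : (a%:A : L^c) * b = b * (a%:A : L^c).
    exact: (etrans (mulr_algr a (b : L)) (esym (mulr_algl a (b : L)))).
  by rewrite !scalerA e.
pose ev (h : {linear M -> M}) : {ffun 'I_n -> restrict_scalars M} := [ffun i => h (g i)].
pose I j : {pred {ffun 'I_n -> restrict_scalars M}} := fun x =>
  `[< exists2 h, GRing.comm f h & x = ev (f ^+ j * h) >].
have [||m mP] := @dcc_power k L artL M n Mfg I.
- move=> j; split.
    apply/asboolP; exists 0; first exact: commr0.
    by apply/ffunP => i; rewrite mulr0 !ffunE.
  move=> a _ _ /asboolP[h ch ->] /asboolP[h' ch' ->]; apply/asboolP.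
  (* Scalars from [k] are central in [L], so a [k]-multiple of [h] is again [L]-linear. *)
  have [|ah ahE] := @linear_map_exists _ M M (fun x => (a%:A : L^c) *: h x).
    by move=> b x y; rewrite linearP scalerDr central.
  exists (ah + h').
    apply: commrD => //; apply: linear_ext => x; rewrite !endo_mulE !ahE linearZ.
    by congr (_ *: _); exact: (congr1 (fun F : {linear M -> M} => F x) ch).
  apply/ffunP => i; rewrite !ffunE mulrDr rscaleE.
  by congr (_ + _); rewrite !endo_mulE ahE linearZ.
- move=> j x /asboolP[h ch ->]; apply/asboolP; exists (f * h).
    by apply: commrM => //; exact: commr_refl.
  by rewrite exprSr mulrA.
(* Stability of the chain, applied to the element of [I m] given by the identity. *)
have: ev (f ^+ m) \in I m.+1.
  by rewrite mP //; apply/asboolP; exists 1; [exact: commr1 | rewrite mulr1].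
case/asboolP => h ch evE; exists m, h; split=> //.
by apply: linear_eq_gen gP _ => i; move/ffunP: evE => /(_ i); rewrite !ffunE.
Qed.

(** Iterating [f ^+ m = f ^+ m.+1 * h] shows that [f ^+ m * h ^+ m] is idempotent. If it is 0 then
    [f ^+ m = 0]; if it is 1 then [f] is invertible. *)
Lemma fitting (M : rmodType L) (f : {linear M -> M}) :
  fin_gen M -> indecomposable M ->
  invertible f \/ exists n, f ^+ n = 0.
Proof.
move=> Mfg indM; have [m [h [ch fmE]]] := endo_strongly_regular f Mfg.
have fE j : f ^+ m = f ^+ (m + j) * h ^+ j.
  elim: j => [|j IH]; first by rewrite addn0 mulr1.
  have e : f ^+ (m + j) = f ^+ (m + j).+1 * h.
    by rewrite -addSn addnC [in RHS]addnC !exprD -mulrA -fmE.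
  by rewrite addnS [h ^+ _]exprS mulrA -e.
have chm : GRing.comm (h ^+ m) (f ^+ m) by apply/commrX/commr_sym/commrX.
have [|e0|e1] := @indecomposable_idempotent _ _ (f ^+ m * h ^+ m) indM.
- by rewrite mulrA -(mulrA (f ^+ m)) chm mulrA -exprD -fE.
- by right; exists m; rewrite (fE m) exprD -mulrA e0 mulr0.
- have cg : GRing.comm f (f ^+ m * h ^+ m.+1).
    by apply: commrM; apply: commrX => //; exact: commr_refl.
  have fg : f * (f ^+ m * h ^+ m.+1) = 1.
    by rewrite mulrA -exprS [h ^+ _]exprS mulrA -fmE.
  by left; exists (f ^+ m * h ^+ m.+1); rewrite // -cg.
Qed.

(** The endomorphism ring is local: if [w] inverts [s + t] and [w * s] is nilpotent, then
    [w * t = 1 - w * s] is invertible. *)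
Lemma invertible_sum (M : rmodType L) (I : finType) (f : I -> {linear M -> M}) :
  fin_gen M -> indecomposable M -> \sum_i f i = 1 ->
  exists i, invertible (f i).
Proof.
move=> Mfg indM fsum.
(* Invertible sums replace sums equal to 1, a property that passes to partial sums. *)
suff: invertible (\sum_i f i) -> exists i, invertible (f i).
  by apply; rewrite fsum; exists 1; rewrite mulr1.
apply: (big_ind (fun s => invertible s -> exists i, invertible (f i))).
- move=> [g _ g0]; case: indM => + _; case=> x.
  by rewrite -[x]/((1 : {linear M -> M}) x) -g0 mul0r.
- move=> s t IHs IHt st_inv; have [w w1 w2] := st_inv.
  have w_cancel r : invertible (w * r) -> invertible r.
    by move=> /(invertibleM st_inv); rewrite mulrA w2 mul1r.
  have [/w_cancel/IHs//|[n /invertible_sub1]] := fitting (w * s) Mfg indM.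
  have -> : 1 - w * s = w * t by rewrite -w1 mulrDr addrAC subrr add0r.
  by move/w_cancel/IHt.
- by move=> i _ fi; exists i.
Qed.

Lemma retract_sum (M : rmodType L) (I : finType) (X : I -> rmodType L)
    (u : forall i, {linear M -> X i}) (v : forall i, {linear X i -> M}) :
  fin_gen M -> indecomposable M -> (forall x, \sum_i v i (u i x) = x) ->
  exists i, retract M (X i).
Proof.
move=> Mfg indM uvP; pose f i : {linear M -> M} := v i \o u i.
have [|i fi] := @invertible_sum M I f Mfg indM.
  by apply: linear_ext => x; rewrite endo_sumE uvP.
by exists i; apply: retract_invertible fi.
Qed.

End Fitting.

(** * Decomposition into indecomposables *)

(** Finite direct sum decompositions, given by inclusions and projections instead of an iterated
    product, in the form that [retract_sum] takes. *)
Definition decomposes (R : nzRingType) (M : rmodType R) :=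
  exists (I : finType) (X : I -> fgmod R)
         (u : forall i, {linear M -> X i}) (v : forall i, {linear X i -> M}),
    [/\ forall i, indecomposable (X i), forall i, cancel (v i) (u i) &
        forall x, \sum_i v i (u i x) = x].

Section Decomposition.
Variable R : nzRingType.
Implicit Types M N A B : rmodType R.

Lemma decomposes_zero M : zero_mod M -> decomposes M.
Proof.
move=> M0; exists void, (of_void _), (fun i : void => match i with end),
  (fun i : void => match i with end).
by split=> [[]|[]|x]; rewrite big1 ?(M0 x) // => -[].
Qed.

Lemma decomposes_indecomposable (M : fgmod R) : indecomposable M -> decomposes M.
Proof.
move=> indM; exists unit, (fun=> M), (fun=> idfun), (fun=> idfun).
by split=> // x; rewrite (big_pred1 tt) // => -[].
Qed.

Lemma decomposes_prod M (A B : fgmod R) :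
  isomorphic M (A * B)%type -> decomposes A -> decomposes B -> decomposes M.
Proof.
move=> [f /linear_inverse[g fK gK]] [I [X [u [v [indX vu uv]]]]]
  [J [Y [s [t [indY ts st]]]]].
pose Z (i : I + J) : fgmod R := match i with inl i => X i | inr j => Y j end.
pose U (i : I + J) : {linear M -> Z i} :=
  match i return {linear M -> Z i} with
  | inl i => (u i \o (fst \o f) : {linear M -> X i})
  | inr j => (s j \o (snd \o f) : {linear M -> Y j})
  end.
pose V (i : I + J) : {linear Z i -> M} :=
  match i return {linear Z i -> M} with
  | inl i => (g \o (@inl_lin _ A B \o v i) : {linear X i -> M})
  | inr j => (g \o (@inr_lin _ A B \o t j) : {linear Y j -> M})
  end.
exists (I + J)%type, Z, U, V.
split=> [[i|j]|[i|j]|x]; [exact: indX | exact: indY | | |].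
- by move=> y /=; rewrite gK /= vu.
- by move=> y /=; rewrite gK /= ts.
rewrite big_sumType /= -!linear_sum uv st -linearD /= -[RHS]fK.
by congr (g _); case: (f x) => a b; congr pair; rewrite /= ?addr0 ?add0r.
Qed.

(** The definition of [indecomposable] ranges over arbitrary modules; the factors found are
    quotients of [M], hence finitely generated. *)
Lemma decomposable_prod (M : fgmod R) :
  ~ zero_mod M -> ~ indecomposable M ->
  exists A B : fgmod R, [/\ isomorphic M (A * B)%type, ~ zero_mod A & ~ zero_mod B].
Proof.
move=> M_neq0 nindM; apply: contrapT => noAB; apply: nindM; split=> // A B fAB.
apply: contrapT => /not_orP[A0 B0]; apply: noAB.
have [f fbij] := fAB.
have Afg : fin_gen A.
  apply: (@fin_gen_surj _ _ _ (fst \o f)) (fgmod_fg M) => a.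
  by case: fbij => g _ gK; exists (g (a, 0)); rewrite /= gK.
have Bfg : fin_gen B.
  apply: (@fin_gen_surj _ _ _ (snd \o f)) (fgmod_fg M) => b.
  by case: fbij => g _ gK; exists (g (0, b)); rewrite /= gK.
by exists (FgMod Afg), (FgMod Bfg).
Qed.

Lemma image_closed (S : pzRingType) (M N : lmodType S) (f : {linear M -> N}) :
  submod_closed (fun y : N => `[< exists x, f x = y >]).
Proof.
split; first by apply/asboolP; exists 0; rewrite linear0.
move=> a _ _ /asboolP[x <-] /asboolP[y <-]; apply/asboolP.
by exists (a *: x + y); rewrite linearP.
Qed.

(* A bad module B with minimal image among those embedded in M is a nontrivial
   product; one of its two factors is bad and has a strictly smaller image. *)
Lemma dcc_decomposes (M : fgmod R) : dcc M -> decomposes M.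
Proof.
move=> dccM; apply: contrapT => badM.
pose C (P : {pred M}) := exists (B : fgmod R) (f : {linear B -> M}),
  [/\ ~ decomposes B, injective f & P = (fun y => `[< exists x, f x = y >])].
have [|| P [B [f [badB finj ->]]] Pmin] := dcc_minimal dccM (C := C).
- by move=> P [B [f [_ _ ->]]]; apply: image_closed.
- by exists (fun y => `[< exists x : M, x = y >]), M, idfun; split=> // x y.
have [A [A' [Biso A0 A'0]]] : exists A A' : fgmod R,
    [/\ isomorphic B (A * A')%type, ~ zero_mod A & ~ zero_mod A'].
  apply: decomposable_prod => [/decomposes_zero|/decomposes_indecomposable] //.
have {Biso} [g /linear_inverse[h gK hK]] := Biso.
have badAA' : ~ decomposes A \/ ~ decomposes A'.
  apply/not_andP => -[dA dA']; apply: badB; apply: decomposes_prod dA dA'.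
  by exists g; exists h.
have hinj := can_inj hK.
(* By minimality of its image, a bad module embedded in [B] fills [B]; a bad factor of [B] thus
   leaves no room for the other one. *)
have surjB (D : fgmod R) (i : {linear D -> B}) :
    ~ decomposes D -> injective i -> surjective i.
  move=> badD iinj b.
  suff /asboolP[x /finj] : f b \in (fun y => `[< exists x, (f \o i) x = y >]) by exists x.
  apply: Pmin; last by apply/asboolP; exists b.
    by exists D, (f \o i); split=> // x y /finj/iinj.
  by move=> y /asboolP[x <-]; apply/asboolP; exists (i x).
case: badAA' => [/(surjB A (h \o @inl_lin _ A A'))|/(surjB A' (h \o @inr_lin _ A A'))] surj.
- apply: A'0 => a'; have [|x /hinj/(congr1 snd)//] := surj _ (h (0, a')).
  by move=> x y /hinj/(congr1 fst).
- apply: A0 => a; have [|x /hinj/(congr1 fst)//] := surj _ (h (a, 0)).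
  by move=> x y /hinj/(congr1 snd).
Qed.

End Decomposition.

(** * Finiteness up to isomorphism *)

Definition finitely_many (R : nzRingType) (C : fgmod R -> Prop) :=
  exists (n : nat) (G : 'I_n -> fgmod R), forall M : fgmod R, C M ->
    exists i, isomorphic M (G i).

Lemma finitely_many_family (R : nzRingType) (C : fgmod R -> Prop)
    (I : finType) (G : I -> fgmod R) :
  (forall M, C M -> exists i, isomorphic M (G i)) -> finitely_many C.
Proof.
move=> CG; exists #|I|, (G \o enum_val) => M /CG[i iG].
by exists (enum_rank i); rewrite /= enum_rankK.
Qed.

Lemma finitely_many_union (R : nzRingType) (I : finType)
    (C : I -> fgmod R -> Prop) :
  (forall i, finitely_many (C i)) -> finitely_many (fun M => exists i, C i M).
Proof.
move=> /(_ _)/cid fmC; pose n i := sval (fmC i).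
pose G i := sval (cid (svalP (fmC i))).
apply: (@finitely_many_family _ _ {i : I & 'I_(n i)} (fun t => G (tag t) (tagged t))).
move=> M [i /(svalP (cid (svalP (fmC i))))[j MG]].
by exists (Tagged (fun i => 'I_(n i)) j).
Qed.

(** As in the Krull-Schmidt theorem: an indecomposable summand of [Y] is a summand of one of its
    indecomposable components, hence isomorphic to it. *)
Lemma finitely_many_retracts (k : comNzRingType) (L : algType k) (Y : fgmod L) :
  artin_algebra L -> finitely_many (fun M => indecomposable M /\ retract M Y).
Proof.
move=> artL; have /dcc_decomposes := dcc_artin artL (fgmod_fg Y).
move=> [I [X [u [v [indX _ uv]]]]]; apply: (finitely_many_family (G := X)).
move=> M [indM [s [r rs]]].
have [|i Mi] := @retract_sum _ _ artL M I X (fun i => u i \o s) (fun i => r \o v i)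
  (fgmod_fg M) indM.
  by move=> x; rewrite /= -linear_sum uv rs.
by exists i; apply: retract_indecomposable Mi; [|case: indM].
Qed.

(** * Quotient modules *)

Section QuotientModule.
Variables (R : pzRingType) (M : lmodType R) (P : {pred M}).
Hypothesis P_closed : submod_closed P.

(** A copy of [P] that carries the closedness proof, so that an instance can be attached to it. *)
Definition quotient_ker (_ : submod_closed P) : {pred M} := P.
HB.instance Definition _ :=
  GRing.isZmodClosed.Build M (quotient_ker P_closed) (GRing.submod_closedB P_closed).

Definition quotient_mod : Type := Quotient.quot (quotient_ker P_closed).
Local Notation Q := quotient_mod.

HB.instance Definition _ := GRing.Zmodule.on Q.
HB.instance Definition _ := Quotient.on Q.

Definition quotient_scale (a : R) (x : Q) : Q := \pi_Q (a *: repr x).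

Lemma quotient_eq (x y : M) : (\pi_Q x == \pi_Q y) = (x - y \in P).
Proof. by rewrite -(Quotient.idealrBE (quotient_ker P_closed)). Qed.

Fact pi_scale a x : \pi_Q (a *: x) = quotient_scale a (\pi_Q x).
Proof.
apply/eqP; rewrite quotient_eq -scalerBr -[_ *: _]addr0.
case: P_closed => P0 Plin; apply: Plin => //.
by rewrite -quotient_eq reprK.
Qed.

Fact quotient_scaleA a b x :
  quotient_scale a (quotient_scale b x) = quotient_scale (a * b) x.
Proof. by rewrite -[x]reprK -(pi_scale b) -(pi_scale a) -(pi_scale (a * b)) scalerA.
Qed.
Fact quotient_scale1 : left_id 1 quotient_scale.
Proof. by move=> x; rewrite -[x]reprK -pi_scale scale1r. Qed.
Fact quotient_scaleDr : right_distributive quotient_scale +%R.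
Proof.
move=> a x y; rewrite -[x]reprK -[y]reprK -raddfD -!(pi_scale a) -raddfD.
by rewrite scalerDr.
Qed.
Fact quotient_scaleDl x : {morph quotient_scale^~ x : a b / a + b}.
Proof. by move=> a b; rewrite -[x]reprK -(pi_scale a) -(pi_scale b) -pi_scale -raddfD scalerDl. Qed.

HB.instance Definition _ := GRing.Zmodule_isLmodule.Build R Q
  quotient_scaleA quotient_scale1 quotient_scaleDr quotient_scaleDl.

Definition quotient_pi (x : M) : Q := \pi_Q x.

Fact quotient_pi_linear : linear quotient_pi.
Proof. by move=> a x y; rewrite /quotient_pi raddfD; congr (_ + _); apply: pi_scale. Qed.

HB.instance Definition _ :=
  GRing.isLinear.Build R M Q _ quotient_pi quotient_pi_linear.

Lemma quotient_pi_surj : surjective quotient_pi.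
Proof. by move=> x; exists (repr x); apply: reprK. Qed.

Lemma quotient_pi_eq0 x : (quotient_pi x == 0) = (x \in P).
Proof. by rewrite -(linear0 quotient_pi) quotient_eq subr0. Qed.

End QuotientModule.

(** * Simple modules *)

Section SimpleModules.
Variable R : nzRingType.
Implicit Types M S T : rmodType R.

Lemma nonzero_element M : ~ zero_mod M -> exists x : M, x != 0.
Proof.
move=> M_neq0; apply: contrapT => noX; apply: M_neq0 => x.
by apply: contrapT => /eqP x_neq0; apply: noX; exists x.
Qed.

(** Absence of nonzero proper submodules, phrased through cyclic generators. *)
Definition simple_mod S :=
  ~ zero_mod S /\ forall x : S, x != 0 -> forall y, exists a : R^c, y = a *: x.

Lemma simple_surj M S (f : {linear M -> S}) x :
  simple_mod S -> f x != 0 -> surjective f.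
Proof.
by move=> [_ Ssimple] /Ssimple gen y; have [a ->] := gen y; exists (a *: x); rewrite linearZ.
Qed.

(* Zorn's lemma is applied to the proper submodules together with the empty
   set, so that the empty chain needs no separate treatment. *)
Lemma maximal_submodule M : fin_gen M -> ~ zero_mod M ->
  exists A : {pred M}, [/\ submod_closed A, exists x, x \notin A &
    forall B : {pred M}, submod_closed B -> {subset A <= B} ->
      (exists2 x, x \in B & x \notin A) -> forall x, x \in B].
Proof.
move=> [n [g gP]] M_neq0.
pose lin (A : set M) := forall (a : R^c) x y, A x -> A y -> A (a *: x + y).
pose ok (A : set M) := lin A /\ exists x, ~ A x.
have lin0 A x : lin A -> A x -> A 0.
  by move=> linA Ax; rewrite -(addNr x) -scaleN1r; apply: linA.
have [|A [[linA [x0 Ax0]] Amax]] := @Zorn_bigcup M ok.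
  move=> F Fok Ftot; split.
    move=> a x y [X FX Xx] [Y FY Yy].
    have [XY|YX] := Ftot X Y FX FY.
      by exists Y => //; apply: (Fok Y FY).1 => //; apply: XY.
    by exists X => //; apply: (Fok X FX).1 => //; apply: YX.
  apply: contrapT => noX.
  have allF x : exists2 X, F X & X x.
    by apply: contrapT => xX; apply: noX; exists x => -[X FX Xx]; apply: xX; exists X.
  (* Finitely many members of a chain lie in the largest of them, which would then contain all
     generators. *)
  have [X [FX X0 Xg]] : exists X, [/\ F X, X 0 & forall i, X (g i)].
    clear gP; elim: n g => [|n IH] g.
      by have [X FX X0] := allF 0; exists X; split=> // -[].
    have [X [FX X0 Xg]] := IH (g \o lift ord0).
    have [Y FY Yg] := allF (g ord0).
    have [XY|YX] := Ftot X Y FX FY; [exists Y|exists X]; split=> //.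
    - exact: XY.
    - by move=> i; case: (unliftP ord0 i) => [j|] -> //; apply/XY/Xg.
    - by move=> i; case: (unliftP ord0 i) => [j|] -> //; [apply: Xg | apply: YX].
  have [linX [x]] := Fok X FX; apply; have [c ->] := gP x.
  apply: (big_ind (fun y => X y)) => // [y z Xy Xz|i _].
    by rewrite -[y]scale1r; apply: linX.
  by rewrite -[_ *: _]addr0; apply: linX.
(* An empty maximal set would be strictly contained in the zero submodule. *)
have A0 : A 0.
  apply: contrapT => A0.
  have Aempty x : ~ A x by move=> /(lin0 _ _ linA).
  apply: (Amax (fun x => x = 0)).
    by split=> [x /Aempty//|] /(_ 0 erefl).
  split=> [a x y -> ->|]; first by rewrite scaler0 addr0.
  by have [x /eqP x_neq0] := nonzero_element M_neq0; exists x.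
exists (fun x => `[< A x >]); split.
- split; first exact/asboolP.
  by move=> a x y /asboolP Ax /asboolP Ay; apply/asboolP/linA.
- by exists x0; apply/asboolP.
move=> B [B0 Blin] AB [x Bx /asboolP Ax] y; apply: contrapT => By.
apply: (Amax (fun z => z \in B)).
  by split=> [z Az|/(_ x Bx)//]; apply: AB; apply/asboolP.
by split=> [a u v|]; [apply: Blin | exists y].
Qed.

Lemma simple_quotient (M : fgmod R) : ~ zero_mod M ->
  exists S : fgmod R, simple_mod S /\ exists p : {linear M -> S}, surjective p.
Proof.
move=> M_neq0.
have [A [Amod [x0 x0A] Amax]] := maximal_submodule (fgmod_fg M) M_neq0.
pose p : {linear M -> quotient_mod Amod} := @quotient_pi _ _ _ Amod.
have psurj : surjective p by apply: quotient_pi_surj.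
exists (FgMod (fin_gen_surj psurj (fgmod_fg M))); split; last by exists p.
split=> [Q0|].
  by move: x0A; rewrite -(quotient_pi_eq0 Amod) -[quotient_pi _ _]/(p x0) (Q0 (p x0)) eqxx.
move=> z z_neq0 w; have [x pxz] := psurj z; have [y pyw] := psurj w.
(* The submodule generated by [A] and [x]; it is all of [M] by maximality of [A]. *)
pose B : {pred M} := fun u => `[< exists a : R^c, u - a *: x \in A >].
have [A0 Alin] := Amod.
have /asboolP[a] : y \in B.
  apply: Amax.
  - split; first by apply/asboolP; exists 0; rewrite scale0r subrr.
    move=> a u v /asboolP[b ub] /asboolP[c vc]; apply/asboolP.
    exists (a * b + c); rewrite scalerDl -scalerA opprD addrACA -scalerBr.
    exact: Alin.
  - by move=> u uA; apply/asboolP; exists 0; rewrite scale0r subr0.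
  - exists x; first by apply/asboolP; exists 1; rewrite scale1r subrr.
    by rewrite -(quotient_pi_eq0 Amod) -[quotient_pi _ _]/(p x) pxz.
rewrite -(quotient_pi_eq0 Amod) -[quotient_pi _ _]/(p _) linearB linearZ subr_eq0.
by rewrite pxz pyw => /eqP ->; exists a.
Qed.

End SimpleModules.

(** * The regular module and projectivity *)

Section RegularModule.
Variable R : nzRingType.

Fact regular_fin_gen : fin_gen (regular_rmod R).
Proof.
exists 1, (fun=> 1) => x; exists (fun=> x : R^c).
by rewrite big_ord1; exact: (esym (mulr1 (x : R^c))).
Qed.

Definition regular_fgmod : fgmod R := FgMod regular_fin_gen.

Lemma regular_map (M : rmodType R) (x : M) :
  exists f : {linear regular_fgmod -> M}, f 1 = x.
Proof.
have [|f fE] := @linear_map_exists _ regular_fgmod M (fun a => (a : R^c) *: x).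
  by move=> a b c; rewrite scalerDl -[a *: b]/((a : R^c) * b) -scalerA.
by exists f; rewrite fE; exact: scale1r.
Qed.

Lemma regular_map_ext (M : rmodType R) (f g : {linear regular_fgmod -> M}) :
  f 1 = g 1 -> f =1 g.
Proof.
move=> fg x; have -> : x = (x : R^c) *: (1 : regular_fgmod).
  exact: (esym (mulr1 (x : R^c))).
by rewrite !linearZ fg.
Qed.

Lemma regular_projective : projective_mod regular_fgmod.
Proof.
move=> A B g gsurj f; have [y gy] := gsurj (f 1).
have [h h1] := regular_map y; exists h.
by apply: (@regular_map_ext B (g \o h) f); rewrite /= h1.
Qed.

Lemma retract_projective (M N : rmodType R) :
  projective_mod N -> retract M N -> projective_mod M.
Proof.
move=> projN [u [v vu]] A B g gsurj f.
have [h hE] := projN A B g gsurj (f \o v).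
by exists (h \o u) => x; have /= -> := hE (u x); rewrite vu.
Qed.

End RegularModule.

(** * Simple modules as tops of indecomposable projectives *)

Section SimpleTops.
Variables (k : comNzRingType) (L : algType k).
Hypothesis artL : artin_algebra L.

(** If [b] did not kill the kernel of [b'], then [(b, b')] would map onto [S * S'], and lifting
    [(b, 0)] would give an endomorphism [c] with [b \o c = b] and [b' \o c = 0]. Invertibility of
    [c] forces [b' = 0], nilpotence forces [b = 0]. *)
Lemma indecomposable_projective_top (P : fgmod L) (S S' : rmodType L)
    (b : {linear P -> S}) (b' : {linear P -> S'}) :
  indecomposable P -> projective_mod P -> simple_mod S -> simple_mod S' ->
  surjective b -> surjective b' ->
  exists phi : {linear S' -> S}, phi \o b' =1 b.
Proof.
move=> indP projP simS simS' bsurj b'surj.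
apply: linear_factor => // x b'x0; apply: contrapT => /eqP bx0.
have [|f fE] := @linear_map_exists _ P (S * S')%type (fun y => (b y, b' y)).
  by move=> a y z; congr pair; rewrite linearP.
have [|g gE] := @linear_map_exists _ P (S * S')%type (fun y => (b y, 0)).
  by move=> a y z; congr pair; rewrite /= ?linearP // scaler0 addr0.
have fsurj : surjective f.
  move=> [s t]; have [y b'y] := b'surj t.
  have [a ax] := simS.2 _ bx0 (s - b y).
  exists (y + a *: x); rewrite fE; congr pair; rewrite linearD linearZ.
    by rewrite /= -ax addrC subrK.
  by rewrite /= b'x0 scaler0 addr0.
have [c cE] := projP _ _ f fsurj g.
have bc y : b (c y) = b y.
  by have := cE y; rewrite /= fE gE => -[].
have b'c y : b' (c y) = 0.
  by have := cE y; rewrite /= fE gE => -[].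
have [[d _ cd]|[n cn0]] := fitting artL c (fgmod_fg P) indP.
  case: simS' => + _; apply=> t; have [y <-] := b'surj t.
  by rewrite -[y]/((1 : {linear P -> P}) y) -cd endo_mulE b'c.
have bcn m y : b ((c ^+ m) y) = b y.
  by elim: m => [|m IH] //; rewrite exprS endo_mulE bc.
by move/eqP: bx0; apply; rewrite -(bcn n) cn0 linear0.
Qed.

(** A simple [S] is a quotient of the regular module, hence of one of its indecomposable summands
    [P i], and so maps onto the chosen simple quotient [T i] of [P i]. *)
Lemma simple_modules_covered : exists (I : finType) (T : I -> fgmod L),
  (forall i, simple_mod (T i)) /\
  forall S : rmodType L, simple_mod S ->
    exists i (phi : {linear S -> T i}), surjective phi.
Proof.
have /dcc_decomposes := dcc_artin artL (fgmod_fg (regular_fgmod L)).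
move=> [I [P [u [v [indP vu uv]]]]].
have top i := simple_quotient (indP i).1.
pose T i := sval (cid (top i)).
have simT i : simple_mod (T i) := (svalP (cid (top i))).1.
exists I, T; split=> // S simS.
have [s s_neq0] := nonzero_element simS.1.
have [f f1] := regular_map s.
have [i [x fvx]] : exists i x, f (v i x) != 0.
  apply: contrapT => fv0; move: s_neq0; rewrite -f1 -(uv 1) linear_sum big1 ?eqxx // => i _.
  by apply/eqP; apply: contrapT => /negP fvu; apply: fv0; exists i, (u i 1).
have projPi : projective_mod (P i).
  by apply: retract_projective (regular_projective (R := L)) _; exists (v i), (u i).
have [p psurj] := (svalP (cid (top i))).2.
have fvsurj : surjective (f \o v i) := simple_surj (f := f \o v i) simS fvx.
have [phi phiE] := indecomposable_projective_top (indP i) projPi (simT i) simS psurj fvsurj.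
exists i, phi => y; have [z <-] := psurj y.
by exists (f (v i z)); rewrite -phiE.
Qed.

End SimpleTops.

(** * Regularity of the stable category *)

Section CokernelFunctor.
Variables (X : preadditive) (A B : X) (f : pre_hom A B).

Lemma pre_comp0l (C D E : X) (h : pre_hom C D) :
  pre_comp (0 : pre_hom D E) h = 0.
Proof. by apply: (addIr (pre_comp 0 h)); rewrite -pre_compDl !add0r. Qed.

Lemma pre_comp0r (C D E : X) (h : pre_hom D E) :
  pre_comp h (0 : pre_hom C D) = 0.
Proof. by apply: (addIr (pre_comp h 0)); rewrite -pre_compDr !add0r. Qed.

Lemma pre_compBr (C D E : X) (h : pre_hom D E) (g g' : pre_hom C D) :
  pre_comp h (g - g') = pre_comp h g - pre_comp h g'.
Proof. by apply: (addIr (pre_comp h g')); rewrite -pre_compDr !subrK. Qed.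

Lemma pre_compBl (C D E : X) (h h' : pre_hom D E) (g : pre_hom C D) :
  pre_comp (h - h') g = pre_comp h g - pre_comp h' g.
Proof. by apply: (addIr (pre_comp h' g)); rewrite -pre_compDl !subrK. Qed.

Section Object.
Variable Z : X.

(** The quotient by this image is the value at [Z] of the cokernel of [(-, f)]. *)
Definition postcomp_image : {pred pre_hom Z B} :=
  fun h => `[< exists g, h = pre_comp f g >].

Fact postcomp_image_closed : zmod_closed postcomp_image.
Proof.
split; first by apply/asboolP; exists 0; rewrite pre_comp0r.
move=> _ _ /asboolP[g ->] /asboolP[g' ->]; apply/asboolP.
by exists (g - g'); rewrite pre_compBr.
Qed.

HB.instance Definition _ := GRing.isZmodClosed.Build (pre_hom Z B)
  postcomp_image postcomp_image_closed.

Definition coker_ob : zmodType := Quotient.quot postcomp_image.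

Definition coker_class (h : pre_hom Z B) : coker_ob := \pi h.

Fact coker_class_additive : zmod_morphism coker_class.
Proof. by move=> g h; rewrite /coker_class raddfB. Qed.
HB.instance Definition _ :=
  GRing.isZmodMorphism.Build (pre_hom Z B) coker_ob coker_class coker_class_additive.

Lemma coker_classP (h h' : pre_hom Z B) :
  coker_class h = coker_class h' <-> exists g, h - h' = pre_comp f g.
Proof.
have E : (h - h' \in postcomp_image) = (coker_class h == coker_class h').
  exact: (@Quotient.idealrBE _ postcomp_image).
split=> [/eqP|hh']; first by rewrite -E => /asboolP.
by apply/eqP; rewrite -E; apply/asboolP.
Qed.

Lemma coker_classK (u : coker_ob) : coker_class (repr u) = u.
Proof. exact: reprK. Qed.

End Object.

Section Map.
Variables (Z W : X) (r : pre_hom Z W).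

Definition coker_map (u : coker_ob W) : coker_ob Z :=
  coker_class (pre_comp (repr u) r).

Lemma coker_mapE (h : pre_hom W B) :
  coker_map (coker_class h) = coker_class (pre_comp h r).
Proof.
apply/coker_classP; rewrite -pre_compBl.
have [g ->] : exists g, repr (coker_class h) - h = pre_comp f g.
  by apply/coker_classP; rewrite coker_classK.
by exists (pre_comp g r); rewrite pre_compA.
Qed.

Fact coker_map_additive : zmod_morphism coker_map.
Proof.
move=> u v; rewrite -(coker_classK u) -(coker_classK v) -raddfB !coker_mapE.
by rewrite -raddfB -pre_compBl.
Qed.
HB.instance Definition _ :=
  GRing.isZmodMorphism.Build (coker_ob W) (coker_ob Z) coker_map coker_map_additive.

End Map.

Fact coker_map1 Z (u : coker_ob Z) : coker_map (pre_id Z) u = u.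
Proof. by rewrite -(coker_classK u) coker_mapE pre_comp1r. Qed.

Fact coker_mapM (Z W V : X) (g : pre_hom W V) (h : pre_hom Z W) (u : coker_ob V) :
  coker_map (pre_comp g h) u = coker_map h (coker_map g u).
Proof. by rewrite -(coker_classK u) !coker_mapE pre_compA. Qed.

Fact coker_mapD (Z W : X) (g h : pre_hom Z W) (u : coker_ob W) :
  coker_map (g + h) u = coker_map g u + coker_map h u.
Proof. by rewrite -(coker_classK u) !coker_mapE -raddfD -pre_compDr. Qed.

Definition coker : cofunctor X :=
  @Cofunctor X (fun Z => coker_ob Z) (fun Z W r => coker_map r)
    coker_map1 coker_mapM coker_mapD.

Definition coker_proj : nattrans (yoneda B) coker :=
  @NatTrans X (yoneda B) coker (fun Z => @coker_class Z)
    (fun Z W r h => esym (coker_mapE r h)).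

Section Postcomp.
Variable Z : X.
Definition postcomp (g : pre_hom Z A) : pre_hom Z B := pre_comp f g.
Fact postcomp_additive : zmod_morphism postcomp.
Proof. by move=> g h; rewrite /postcomp pre_compBr. Qed.
HB.instance Definition _ :=
  GRing.isZmodMorphism.Build (pre_hom Z A) (pre_hom Z B) postcomp postcomp_additive.
End Postcomp.

Definition yoneda_post : nattrans (yoneda A) (yoneda B) :=
  @NatTrans X (yoneda A) (yoneda B) (fun Z => @postcomp Z)
    (fun Z W r h => pre_compA f h r).

Lemma coker_fin_presented : fin_presented coker.
Proof.
exists A, B, yoneda_post, coker_proj => Z; split=> [h|u]; last first.
  by exists (repr u); apply: coker_classK.
rewrite -[coker_proj Z h]/(coker_class h) -(raddf0 (@coker_class Z)).
by rewrite coker_classP subr0; split=> -[g gh]; exists g.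
Qed.

End CokernelFunctor.

Lemma yoneda_fin_presented (X : preadditive) (B : X) : fin_presented (yoneda B).
Proof.
have nat0 (Z W : X) (r : pre_hom Z W) (h : yoneda B W) :
    (\0 : {additive yoneda B Z -> yoneda B Z}) (fun_map (yoneda B) r h) =
    fun_map (yoneda B) r ((\0 : {additive yoneda B W -> yoneda B W}) h).
  exact: (esym (pre_comp0l B r)).
exists B, B, (@NatTrans X (yoneda B) (yoneda B) (fun=> \0) nat0), (nat_id _) => Z.
by split=> h; [split=> [/= ->|[]] // ; exists 0 | exists h].
Qed.

(* A splitting of (-, B) -> coker (-, f) is, by the Yoneda lemma, an
   endomorphism s of B with f \o g = 1 - s and s \o f = 0. *)
Lemma projective_coker_regular (X : preadditive) :
  (forall P : fpfun_cat X, projective_object P) ->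
  forall (A B : X) (f : pre_hom A B),
    exists g : pre_hom B A, pre_comp f (pre_comp g f) = f.
Proof.
move=> proj A B f.
pose Y : fpfun_cat X := exist _ _ (yoneda_fin_presented B).
pose F : fpfun_cat X := exist _ _ (coker_fin_presented f).
pose p : cat_hom Y F := coker_proj f.
(* The projection [p] is epi, so projectivity of [F] lifts the identity to a section [s]. *)
have [|s sp] := proj F Y F p _ (cat_id F).
  move=> G g h gph; apply: nattrans_ext => Z u.
  rewrite -(coker_classK u).
  exact: (congr1 (fun t : nattrans (yoneda B) (sval G) => t Z (repr u)) gph).
have spE Z u : coker_class f (s Z u) = u.
  exact: (congr1 (fun t : nattrans (coker f) (coker f) => t Z u) sp).
pose e := s B (coker_class f (pre_id B)).
have [g gE] : exists g, pre_id B - e = pre_comp f g.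
  by apply/coker_classP; rewrite spE.
exists g; rewrite pre_compA -gE pre_compBl pre_comp1l.
(* By naturality of [s], this composite is the value of [s] at the class of [f], which is zero. *)
suff -> : pre_comp e f = 0 by rewrite subr0.
have := @nat_natural X (coker f) (yoneda B) s A B f (coker_class f (pre_id B)).
rewrite -[fun_map (yoneda B) f _]/(pre_comp e f) => <-.
rewrite -[fun_map _ _ _]/(coker_map f (coker_class f (pre_id B))) coker_mapE pre_comp1l.
have -> : coker_class f f = 0; last exact: raddf0.
rewrite -(raddf0 (@coker_class _ _ _ f A)); apply/coker_classP.
by exists (pre_id A); rewrite subr0 pre_comp1r.
Qed.

Lemma nilpotent_factors_projective (R : nzRingType) (M N : fgmod R)
    (h : {linear M -> N}) (e : {linear M -> M}) n :
  stable_class (lin_comp h e) = stable_class h -> e ^+ n = 0 ->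
  factors_projective h.
Proof.
move=> heE en0.
have hE m : stable_class (lin_comp h (e ^+ m)) = stable_class h.
  elim: m => [|m IH]; first by congr stable_class; apply: linear_ext.
  rewrite -[RHS]IH -[RHS]stable_compE -heE stable_compE.
  by congr stable_class; apply: linear_ext => x; rewrite exprS.
have := hE n; rewrite en0 => /esym/stable_classP[P pP [g [r E]]].
by exists P => //; exists g, r => x; rewrite -E /= linear0 subr0.
Qed.

(** A representative of the stable quasi-inverse [g] gives an honest endomorphism of [M], so
    Fitting's lemma yields a retraction of modules and not merely a stable one. *)
Lemma retract_or_factors_projective (k : comNzRingType) (L : algType k)
    (M N : gpmod L) (h : {linear M -> N}) :
  OmegaG_algebra L -> indecomposable M -> retract M N \/ factors_projective h.
Proof.
move=> [artL _ [_ proj]] indM.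
have [g gE] := projective_coker_regular proj (stable_class h : pre_hom (M : stable_Gprj L) N).
pose e : {linear M -> M} := repr g \o h.
have [/retract_invertible|[n en0]] := fitting artL e (fgmod_fg M) indM.
  by left.
right; apply: nilpotent_factors_projective en0.
rewrite -[RHS]gE -[g]stable_classK /= stable_compE stable_compE.
by congr stable_class.
Qed.

Theorem proposition2p4 (k : comNzRingType) (Lambda : algType k) :
  OmegaG_algebra Lambda -> CM_finite Lambda.
Proof.
move=> OmegaL; have [artL contra _] := OmegaL.
have [I [T [simT Tcover]]] := simple_modules_covered artL.
pose X i := sval (cid (contra (T i))).
have XP i := svalP (cid (contra (T i))).
(* [None] accounts for the case in which the lift [h] is stably zero. *)
pose Y (o : option I) : fgmod Lambda := if o is Some i then X i else regular_fgmod Lambda.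
suff MY (M : fgmod Lambda) : gorenstein_projective M -> indecomposable M ->
    exists o, retract M (Y o).
  have [n [G GP]] := finitely_many_union (fun o => finitely_many_retracts (Y o) artL).
  exists n, G => M gpM indM; apply: GP.
  by have [o MYo] := MY M gpM indM; exists o.
move=> gpM indM.
have [S [simS [q qsurj]]] := simple_quotient indM.1.
have [i [phi phisurj]] := Tcover S simS.
pose f : {linear M -> T i} := phi \o q.
have fsurj : surjective f.
  by move=> t; have [s <-] := phisurj t; have [x <-] := qsurj s; exists x.
have [p [gpX approx]] := XP i.
have [h hE] := approx M gpM f.
have [MX|[Q projQ [g [r hgr]]]] :=
    @retract_or_factors_projective _ _ (GpMod gpM) (GpMod gpX) h OmegaL indM.
  by exists (Some i).
exists None.
have [t t_neq0] := nonzero_element (simT i).1.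
have [b b1] := regular_map t.
have bsurj : surjective b by apply: (@simple_surj _ _ _ _ 1); rewrite ?b1.
(* Lifting [p \o g] through [b], then [b] through [f], rewrites [f = p \o g \o r] as
   [f = f \o c \o d \o r]. *)
have [d dE] := projQ _ _ b bsurj (p \o g).
have [c cE] := @regular_projective Lambda _ _ f fsurj b.
pose e : {linear M -> M} := c \o (d \o r).
have fe x : f (e x) = f x.
  rewrite -[LHS]/((f \o c) _) cE -[LHS]/((b \o d) _) dE -[RHS]hE.
  by rewrite /= hgr.
have [|[n en0]] := fitting artL e (fgmod_fg M) indM.
  exact: retract_invertible.
have fen m x : f ((e ^+ m) x) = f x.
  by elim: m => [|m IH] //; rewrite exprS endo_mulE fe.
(* A nilpotent [e] with [f \o e = f] would make [f] vanish, although it reaches the nonzero [t]. *)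
have [x fxt] := fsurj t; case/eqP: t_neq0.
by rewrite -fxt -(fen n) en0 linear0.
Qed.
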